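(* Let $n\ge 1$. The mapping $(a_1,\ldots,a_k)\mapsto F=\underline{a_k}\cdot\underline{a_{k-1}}\cdots\underline{a_1}$ is a bijection $\mathrm{QSeq}_n\to\mathsf{ZigZag}_n$. Under this bijection, $\mathfrak{F}_a=\mathfrak{P}_F$.
   Context: $\mathbb{N}=\{1,2,\ldots\}$. Sequences: $\mathrm{QSeq}_n$ is the set of finite sequences $(a_1,\ldots,a_k)$ of positive integers with $a_1=n$ and $a_i-a_{i+1}\in\{0,1\}$ for $1\le i\le k-1$; the empty sequence is included. For a sequence $a=(a_1,\ldots,a_k)$ of positive integers, let $\mathcal{C}(a)$ be the set of sequences $(i_1,\ldots,i_k)$ of positive integers with $i_j\le a_j$ for all $j$, $i_j\ge i_{j+1}$ for all $1\le j<k$, and $i_j>i_{j+1}$ whenever $a_j>a_{j+1}$. The slide polynomial is $\mathfrak{F}_a=\sum_{(i_1,\ldots,i_k)\in\mathcal{C}(a)}x_{i_1}\cdots x_{i_k}$ (when $a\in\mathrm{QSeq}_n$ it is called a fundamental quasisymmetric polynomial; $\mathfrak{F}_{()}=1$). Forests: a binary tree is a finite rooted plane tree in which each node is either a leaf (no children) or internal, having an ordered pair of children $v_L,v_R$; $\ast$ is the tree with a single node (a leaf). An indexed forest is an infinite sequence $F=(T_1,T_2,\ldots)$ of binary trees, all but finitely many equal to $\ast$; $\mathsf{For}$ is the set of indexed forests, and $\varnothing$ is the forest all of whose trees are $\ast$. The leaves of $F$, read from left to right, are identified with $1,2,3,\ldots$. $\mathrm{IN}(F)$ is the finite set of internal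 nodes. For $v\in \mathrm{IN}(F)$, $\rho_F(v)\in\mathbb{N}$ is the leaf reached from $v$ by repeatedly passing to the left child. A node is terminal if it is internal and both its children are leaves; $\mathrm{LTer}(F)=\{\rho_F(v):v\text{ terminal}\}$. $\mathsf{ZigZag}_n=\{F\in\mathsf{For}:\mathrm{LTer}(F)\subset\{n\}\}$. The product $F\cdot G$ is obtained by identifying, for each $i$, the $i$-th leaf of $F$ with the root of the $i$-th tree of $G$; this is a monoid structure with identity $\varnothing$ (the empty product). $\underline{i}$ is the forest whose only nontrivial tree is its $i$-th tree, which has exactly one internal node. Forest polynomials: let $\mathcal{C}(F)$ be the set of $\kappa:\mathrm{IN}(F)\to\mathbb{N}$ such that for all $v\in \mathrm{IN}(F)$: $\kappa(v)\le\rho_F(v)$; if $v_L\in \mathrm{IN}(F)$ then $\kappa(v)\le\kappa(v_L)$; if $v_R\in \mathrm{IN}(F)$ then $\kappa(v)<\kappa(v_R)$. Then $\mathfrak{P}_F=\sum_{\kappa\in\mathcal{C}(F)}\prod_{v\in \mathrm{IN}(F)}x_{\kappa(v)}$. *)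

(* Defs.v *)
From mathcomp Require Import all_boot all_algebra finmap.
From mathcomp Require Import boolp classical_sets functions cardinality fsbigop.
From mathcomp Require Import monalg.

Set Implicit Arguments.
Unset Strict Implicit.
Unset Printing Implicit Defensive.

Import GRing.Theory.

Local Open Scope classical_set_scope.
Local Open Scope nat_scope.

(* Polynomials with integer coefficients in the variables x_0, x_1, x_2, ...;
   only the variables of positive index occur below. *)
Definition zpoly : comNzRingType := {malg int[{cmonom nat}]}.

Definition xvar (i : nat) : zpoly := (<< ucm i >> : {malg int[{cmonom nat}]})%R.

(* Sequences are stored from index 0, i.e.
   a_j of the mathematical text is [nth 0 a j.-1]. *)

Definition QSeq (n : nat) : set (seq nat) :=
  [set a | [/\ (forall j, j < size a -> 0 < nth 0 a j),
               (a <> [::] -> nth 0 a 0 = n) &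
               forall j, j.+1 < size a ->
                 nth 0 a j = nth 0 a j.+1 \/ nth 0 a j = (nth 0 a j.+1).+1]].

Definition compatible_seq (a : seq nat) : set (seq nat) :=
  [set s | [/\ size s = size a,
               (forall j, j < size a -> 0 < nth 0 s j <= nth 0 a j),
               (forall j, j.+1 < size a -> nth 0 s j >= nth 0 s j.+1) &
               forall j, j.+1 < size a ->
                 nth 0 a j > nth 0 a j.+1 -> nth 0 s j > nth 0 s j.+1]].

(* [\sum_(_ \in A)] and [\big[*%R/1]_(_ \in A)] over classical sets are
   meaningful when the support is finite; see [finite_compatible_seq], [finite_IN] and
   [finite_compatible_lab] below. *)
Definition slide_poly (a : seq nat) : zpoly :=
  (\sum_(s \in compatible_seq a) \prod_(i <- s) xvar i)%R.

(* A node is addressed by the path leading to it from the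
    root: [false] goes to the left child, [true] to the right child. *)

Inductive bintree := Leaf | Node of bintree & bintree.

Fixpoint nleaves (t : bintree) : nat :=
  if t is Node l r then nleaves l + nleaves r else 1.

Fixpoint subtree (t : bintree) (p : seq bool) : option bintree :=
  match p, t with
  | [::], _ => Some t
  | false :: p', Node l _ => subtree l p'
  | true :: p', Node _ r => subtree r p'
  | _ :: _, Leaf => None
  end.

Definition internal_at (t : bintree) (p : seq bool) : bool :=
  if subtree t p is Some (Node _ _) then true else false.

Definition leaf_at (t : bintree) (p : seq bool) : bool :=
  if subtree t p is Some Leaf then true else false.

Fixpoint leaves_before (t : bintree) (p : seq bool) : nat :=
  match p, t with
  | false :: p', Node l _ => leaves_before l p'
  | true :: p', Node l r => nleaves l + leaves_before r p'
  | _, _ => 0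
  end.

Fixpoint leftmost_path (t : bintree) : seq bool :=
  if t is Node l _ then false :: leftmost_path l else [::].

(* Replaces the leaves of [t], from left to right, by g s, g (s + 1), ... *)
Fixpoint graft (t : bintree) (g : nat -> bintree) (s : nat) : bintree :=
  if t is Node l r then Node (graft l g s) (graft r g (s + nleaves l)) else g s.

(* The tree T_i of the mathematical text is [trees F i.-1];
    leaf labels and variable indices start at 1. *)

Record indexed_forest := IndexedForest {
  trees :> nat -> bintree;
  trees_trivial : exists N, forall i, N <= i -> trees i = Leaf
}.

Definition leaf_offset (F : indexed_forest) (i : nat) : nat :=
  \sum_(j < i) nleaves (F j).

(* A node of a forest: the index of its tree, and its address in that tree. *)
Definition fnode : Type := (nat * seq bool)%type.

Definition internal (F : indexed_forest) (v : fnode) : bool :=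
  internal_at (F v.1) v.2.

Definition leaf (F : indexed_forest) (v : fnode) : bool :=
  leaf_at (F v.1) v.2.

Definition lchild (v : fnode) : fnode := (v.1, rcons v.2 false).
Definition rchild (v : fnode) : fnode := (v.1, rcons v.2 true).

Definition leaf_label (F : indexed_forest) (v : fnode) : nat :=
  (leaf_offset F v.1 + leaves_before (F v.1) v.2).+1.

Definition IN (F : indexed_forest) := {v : fnode | internal F v}.

Definition leftmost_leaf (F : indexed_forest) (v : fnode) : fnode :=
  (v.1, v.2 ++ leftmost_path (odflt Leaf (subtree (F v.1) v.2))).

Definition rho (F : indexed_forest) (v : fnode) : nat :=
  leaf_label F (leftmost_leaf F v).

Definition terminal (F : indexed_forest) (v : fnode) : bool :=
  [&& internal F v, leaf F (lchild v) & leaf F (rchild v)].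

Definition LTer (F : indexed_forest) : set nat :=
  [set rho F v | v in [set v | terminal F v]].

Definition ZigZag (n : nat) : set indexed_forest :=
  [set F | LTer F `<=` [set n]].

Lemma empty_forest_trivial :
  exists N, forall i, N <= i -> (fun=> Leaf : bintree) i = Leaf.
Proof. by exists 0. Qed.

Definition empty_forest : indexed_forest := IndexedForest empty_forest_trivial.

Lemma leaf_offset_ge (F : indexed_forest) (i : nat) : i <= leaf_offset F i.
Proof.
rewrite /leaf_offset -[X in X <= _]card_ord -sum1_card; apply: leq_sum => j _.
by elim: (F j) => //= l IHl r _; apply: leq_trans IHl (leq_addr _ _).
Qed.

Lemma forest_mul_trivial (F G : indexed_forest) :
  exists N, forall i, N <= i -> graft (F i) G (leaf_offset F i) = Leaf.
Proof.
have [[M FM] [N GN]] := (trees_trivial F, trees_trivial G).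
exists (maxn M N) => i; rewrite geq_max => /andP[/FM-> Ni] /=.
exact/GN/(leq_trans Ni)/leaf_offset_ge.
Qed.

Definition forest_mul (F G : indexed_forest) : indexed_forest :=
  IndexedForest (forest_mul_trivial F G).

Lemma underline_trivial (i : nat) :
  exists N, forall j, N <= j ->
    (if j.+1 == i then Node Leaf Leaf else Leaf) = Leaf.
Proof. by exists i => j /leq_trans/(_ (leqnn _)); case: eqP => // <-; rewrite ltnn. Qed.

(* Meaningful for i >= 1. *)
Definition underline (i : nat) : indexed_forest :=
  IndexedForest (underline_trivial i).

Definition seq_forest (a : seq nat) : indexed_forest :=
  \big[forest_mul/empty_forest]_(i <- rev a) underline i.

Definition compatible_lab (F : indexed_forest) : set (IN F -> nat) :=
  [set kappa | forall v : IN F,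
    [/\ 0 < kappa v <= rho F (val v),
        (forall w : IN F, val w = lchild (val v) -> kappa v <= kappa w) &
        (forall w : IN F, val w = rchild (val v) -> kappa v < kappa w)]].
Arguments compatible_lab : clear implicits.

Definition forest_poly (F : indexed_forest) : zpoly :=
  (\sum_(kappa \in compatible_lab F)
     \big[*%R/1]_(v \in [set: IN F]) xvar (kappa v))%R.

Lemma finite_bounded_seq (k N : nat) :
  finite_set [set s : seq nat | size s = k /\ forall j, j < k -> nth 0 s j <= N].
Proof.
apply: (@sub_finite_set _ _
  [set [seq nat_of_ord i | i <- t] | t in [set: k.-tuple 'I_N.+1]]).
  move=> s /= [sk sN]; have st : size [seq (inord i : 'I_N.+1) | i <- s] == k.
    by rewrite size_map sk.
  exists (Tuple st) => //=; rewrite -map_comp; apply: (@eq_from_nth _ 0).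
    by rewrite size_map.
  move=> j; rewrite size_map => js; rewrite (nth_map 0) //= inordK // ltnS sN //.
  by rewrite -sk.
exact/finite_image/finite_finset.
Qed.

Lemma finite_compatible_seq (a : seq nat) : finite_set (compatible_seq a).
Proof.
apply: sub_finite_set (finite_bounded_seq (size a) (\sum_(i <- a) i)) => s.
case=> sa bnd _ _; split=> // j ja; have /andP[_ /leq_trans->//] := bnd j ja.
by rewrite (big_nth 0) big_mkord (bigD1 (Ordinal ja)) //= leq_addr.
Qed.

Lemma finite_internal_at (t : bintree) : finite_set [set p | internal_at t p].
Proof.
elim: t => [|l IHl r IHr]; first by apply: (sub_finite_set _ (finite_set0 _)); case=> // -[].
apply: (@sub_finite_set _ _ ([set [::]] `|`
  (cons false @` [set p | internal_at l p] `|`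
   cons true @` [set p | internal_at r p]))).
  case=> [|[] p] ip; [by left | right; right | right; left]; by exists p.
by rewrite !finite_setU; split; [exact: finite_set1 | split; exact: finite_image].
Qed.

Lemma finite_internal (F : indexed_forest) : finite_set [set v | internal F v].
Proof.
have [N FN] := trees_trivial F.
apply: (@sub_finite_set _ _ (\bigcup_(i in `I_N)
  (pair i @` [set p | internal_at (F i) p]))); last first.
  apply: bigcup_finite; first exact: finite_II.
  by move=> i _; exact/finite_image/finite_internal_at.
case=> i p ip; exists i; last by exists p.
by rewrite /= ltnNge; apply/negP => /FN Fi; move: ip; rewrite /internal /= Fi; case: p => // -[].
Qed.

Lemma finite_IN (F : indexed_forest) : finite_set [set: IN F].
Proof.
have := finite_preimage (f := val : IN F -> fnode) _ (finite_internal F).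
move=> /(_ (in2W val_inj)); apply: sub_finite_set => v _ /=; exact: valP.
Qed.

Lemma finite_compatible_lab (F : indexed_forest) : finite_set (compatible_lab F).
Proof.
have [s sP] : exists s : seq (IN F), forall v, v \in s.
  have /finite_seqP[s sT] := finite_IN F.
  by exists s => v; have : [set` s] v by rewrite -sT.
pose f (kappa : IN F -> nat) := map kappa s.
have finj : injective f.
  by move=> k1 k2 /eq_in_map k12; apply/funext => v; exact: k12.
have fin := finite_bounded_seq (size s) (\sum_(v <- s) rho F (val v)).
apply: sub_finite_set (finite_preimage (in2W finj) fin) => kappa kC.
split=> [|j js]; first by rewrite size_map.
have v0 : IN F by case: (s) js.
rewrite (nth_map v0) //; have [/andP[_ kb] _ _] := kC (nth v0 s j).
apply: leq_trans kb _; rewrite (big_nth v0) big_mkord (bigD1 (Ordinal js)) //=; exact: leq_addr.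
Qed.

(* Main.v *)
Require Import Defs.
From mathcomp Require Import all_boot.
From mathcomp Require Import classical_sets functions.
From mathcomp Require Import ssralg boolp fsbigop zify.

(** Read the sequence backwards: b = rev a starts at a_k, ends at n, and rises
    by 0 or 1 at each step. Multiplying a forest on the left by [underline x]
    joins its trees x and x+1 under a new root and leaves the labels of the
    leaves unchanged. If the forest has a single nontrivial tree, at place y,
    then for x = y this tree becomes a left child, for x = y - 1 a right child,
    and the result again has one nontrivial tree, at place x. So the forest of
    a is one zigzag: a tree whose internal nodes form a path from the root,
    turning left where b is constant and right where b rises
    ([seq_forest_single_tree]). The internal node of depth j has b_j as the
    label of its leftmost leaf ([zigzag_label]), since that label goes up by one
    exactly at right turns. The only terminal node is the last one, of label n,
    so the forest lies in ZigZag n.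

    Conversely, every nontrivial tree has a terminal node, and terminal nodes
    in disjoint subtrees have different labels, as these label different leaves.
    Hence a forest whose terminal nodes all have label n has at most one
    nontrivial tree ([ZigZag_single_tree]), and each node of this tree has at
    most one internal child ([one_terminal_tree]), which makes it a zigzag. Its
    turns and its position recover b, so the map is bijective.

    For the polynomials, the internal nodes of the zigzag are indexed by their
    depth, so a labeling of them is a sequence r of the length of b. The
    conditions on forest labelings then say that r_j <= b_j, and that r is weakly
    increasing, strictly where b rises; these are the conditions on compatible
    sequences, read backwards ([compatible_depth_labeling] and
    [compatible_seq_rev]). The monomials agree factor by factor. *)

Set Implicit Arguments.
Unset Strict Implicit.
Unset Printing Implicit Defensive.

Local Open Scope nat_scope.

(** * Forests with one nontrivial tree *)

Lemma indexed_forest_ext (F G : indexed_forest) : trees F =1 trees G -> F = G.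
Proof.
case: F G => [f fN] [g gN] /= /funext fg; move: gN; rewrite -fg => gN.
by congr IndexedForest; exact: Prop_irrelevance.
Qed.

Lemma single_tree_trivial (i : nat) (t : bintree) :
  exists N, forall j, N <= j -> (if j == i then t else Leaf) = Leaf.
Proof. by exists i.+1 => j; case: eqP => // ->; rewrite ltnn. Qed.

Definition single_tree (i : nat) (t : bintree) : indexed_forest :=
  IndexedForest (single_tree_trivial i t).

Lemma leaf_offset_leaves (F : indexed_forest) (i : nat) :
  (forall j, j < i -> F j = Leaf) -> leaf_offset F i = i.
Proof.
move=> Fi; rewrite /leaf_offset -[RHS]card_ord -sum1_card.
by apply: eq_bigr => j _; rewrite Fi.
Qed.

Lemma leaf_offset_single_tree (i : nat) (t : bintree) :
  leaf_offset (single_tree i t) i = i.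
Proof. by apply: leaf_offset_leaves => j; rewrite /= ltn_neqAle; case: eqP. Qed.

Lemma single_tree_inj (i j : nat) (t u : bintree) : t <> Leaf ->
  single_tree i t = single_tree j u -> i = j /\ t = u.
Proof.
move=> t0 /(congr1 (fun F : indexed_forest => F i)) /=; rewrite eqxx.
by case: eqP => // ->.
Qed.

(** * Left multiplication by a generator *)

Lemma leaf_offset_underline (x j : nat) :
  leaf_offset (underline x.+1) j = j + (x < j).
Proof.
rewrite /leaf_offset /=; elim: j => [|j IHj]; first by rewrite big_ord0.
rewrite big_ord_recr /= IHj eqSS ltnS.
by case: (ltngtP j x) => _; rewrite /= ?addn0 ?addn1 ?addn2.
Qed.

(** Left multiplication by a generator joins two neighbouring trees; the shift
    by [x < j] is there because the joined trees use up two places. *)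
Lemma underline_mulE (x : nat) (G : indexed_forest) (j : nat) :
  forest_mul (underline x.+1) G j =
  if j == x then Node (G x) (G x.+1) else G (j + (x < j)).
Proof.
rewrite /= eqSS leaf_offset_underline; case: eqP => [->|//] /=.
by rewrite ltnn addn0 addn1.
Qed.

(** The list gives the side of the internal child at each internal node, [true]
    for right. The last entry concerns a node with two leaves, where either
    side gives the same tree. *)
Fixpoint zigzag_tree (d : seq bool) : bintree :=
  match d with
  | [::] => Leaf
  | false :: d' => Node (zigzag_tree d') Leaf
  | true :: d' => Node Leaf (zigzag_tree d')
  end.

(** The one step of the construction: the tree at place x or x + 1 becomes the
    left or right child of the new root, which stands at place x. *)
Lemma underline_mul_single_tree (x : nat) (c : bool) (d : seq bool) :
  forest_mul (underline x.+1) (single_tree (x + c) (zigzag_tree d)) =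
  single_tree x (zigzag_tree (c :: d)).
Proof.
apply: indexed_forest_ext => j; rewrite underline_mulE /=.
case: c => /=; rewrite ?addn1 ?addn0 ?eqxx ?(gtn_eqF (ltnSn x)) ?(ltn_eqF (ltnSn x)).
  case: (ltngtP j x) => jx //=; first by rewrite addn0 (ltn_eqF (leqW jx)).
  by rewrite addn1 eqSS gtn_eqF.
case: (ltngtP j x) => jx //=; first by rewrite addn0 ltn_eqF.
by rewrite addn1 (gtn_eqF (leqW jx)).
Qed.

(** * Sequences read backwards *)

(** Where a sequence with rises 0 and 1 goes up. The last entry is [false], as
    the head of the empty tail defaults to [x]. *)
Fixpoint steps (b : seq nat) : seq bool :=
  if b is x :: b' then (x != head x b') :: steps b' else [::].

Lemma size_steps (b : seq nat) : size (steps b) = size b.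
Proof. by elim: b => //= x b ->. Qed.

Definition slow_rise : rel nat := fun x y => (y == x) || (y == x.+1).

(** The default [n] of [last] lets the empty sequence in. *)
Definition rev_QSeq (n : nat) (b : seq nat) : Prop :=
  [/\ all (ltn 0) b, last n b = n & sorted slow_rise b].

Lemma QSeq_rev (n : nat) (b : seq nat) : QSeq n (rev b) <-> rev_QSeq n b.
Proof.
have steprP j : nth 0 (rev b) j = nth 0 (rev b) j.+1 \/
    nth 0 (rev b) j = (nth 0 (rev b) j.+1).+1 <->
    slow_rise (nth 0 (rev b) j.+1) (nth 0 (rev b) j).
  by rewrite /slow_rise; split=> [[->|->]|/orP[/eqP|/eqP]]; rewrite ?eqxx ?orbT; auto.
have srtP : sorted slow_rise b = sorted (fun x y => slow_rise y x) (rev b).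
  by rewrite -{1}[b]revK rev_sorted.
have lastP : (rev b <> [::] -> nth 0 (rev b) 0 = n) <-> last n b = n.
  case/lastP: b {steprP srtP} => [|b x]; first by split.
  by rewrite rev_rcons last_rcons /=; split=> [->|->].
split=> [[pos hd st]|[pos hd st]]; split.
- by rewrite -all_rev; apply/(all_nthP 0).
- exact/lastP.
- by rewrite srtP; apply/(sortedP 0) => j /st/steprP.
- by apply/(all_nthP 0); rewrite all_rev.
- exact/lastP.
- by move=> j jb; apply/steprP; move: st; rewrite srtP => /(sortedP 0)/(_ j jb).
Qed.

(** For [b] empty the two defaults agree: [x = n] and the rise is 0. This lets
    the inductions below start from the empty sequence. *)
Lemma rev_QSeq_cons (n x : nat) (b : seq nat) : rev_QSeq n (x :: b) ->
  [/\ rev_QSeq n b, 0 < x & head n b = x + (x != head x b)].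
Proof.
case=> /= /andP[x0 pos]; case: b pos => [|y b] //= pos hd.
  by move=> _; split=> //; rewrite eqxx addn0.
case/andP=> xy st; split=> //.
by case/orP: xy => /eqP ->; rewrite ?eqxx ?addn0 // ltn_eqF ?addn1.
Qed.

(** * The forest of a sequence is a zigzag *)

Lemma seq_forest_single_tree (n : nat) (b : seq nat) : 1 <= n -> rev_QSeq n b ->
  seq_forest (rev b) = single_tree (head n b).-1 (zigzag_tree (steps b)).
Proof.
move=> n0; rewrite /seq_forest revK; elim: b => [|x b IHb].
  by move=> _; rewrite big_nil; apply: indexed_forest_ext => j /=; case: eqP.
case/rev_QSeq_cons=> /IHb {}IHb x0 hdb; rewrite big_cons IHb hdb /=.
by case: x x0 {hdb} => // x _; rewrite addSn underline_mul_single_tree.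
Qed.

(** The tree gives the turns and the head gives the starting value. The only
    shape that comes from both turns is the node with two leaves, where both
    tails are empty. *)
Lemma zigzag_steps_inj (n : nat) (b c : seq nat) : rev_QSeq n b -> rev_QSeq n c ->
  head n b = head n c -> zigzag_tree (steps b) = zigzag_tree (steps c) -> b = c.
Proof.
elim: b c => [|x b IHb] [|y c] //; [by move=> _ _ _ /=; case: ifP..|].
move=> /rev_QSeq_cons[bn _ hb] /rev_QSeq_cons[cn _ hc] /= exy; subst y.
have zz0 b' : zigzag_tree (steps b') = Leaf -> b' = [::].
  by case: b' => //= z b'; case: ifP.
case: ifP hb hc => bx; case: ifP => cx hb hc; case.
- by move=> ebc; congr cons; apply: IHb; rewrite // hb hc.
- by move=> /esym/zz0 -> /zz0 ->.
- by move=> /zz0 -> /esym/zz0 ->.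
- by move=> ebc; congr cons; apply: IHb; rewrite // hb hc.
Qed.

Lemma nth_rev_QSeq (n : nat) (b : seq nat) (j : nat) : rev_QSeq n b -> j < size b ->
  nth 0 b j = head n b + count id (take j (steps b)).
Proof.
elim: b j => // x b IHb [|j] /rev_QSeq_cons[bn _ hb]; first by rewrite addn0.
by rewrite ltnS /= => jb; rewrite (IHb _ bn jb) hb addnA.
Qed.

Lemma nth_steps (b : seq nat) (j : nat) : j.+1 < size b ->
  nth false (steps b) j = (nth 0 b j != nth 0 b j.+1).
Proof. by elim: b j => // x [|y b] IHb [|j] //= jb; exact: IHb. Qed.

(** * Internal nodes and their labels *)

(** The internal nodes lie on one path, so their addresses are the proper
    prefixes of the list of turns. *)
Lemma internal_zigzag (d p : seq bool) :
  internal_at (zigzag_tree d) p = (size p < size d) && prefix p d.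
Proof.
elim: d p => [|c d IHd] [|e p]; [by []|by case: e| |].
  by rewrite prefix0s; case: c.
by case: c; case: e; rewrite /= ?andbF ?ltnS -?IHd //; case: p => // -[].
Qed.

(** Only a right turn passes leaves on its left, and it passes exactly one. *)
Lemma leaves_before_zigzag (d : seq bool) (j : nat) :
  leaves_before (zigzag_tree d) (take j d) = count id (take j d).
Proof. by elim: d j => // -[] d IHd [|j] //=; rewrite IHd. Qed.

Lemma leaves_before_leftmost (t : bintree) (p : seq bool) :
  leaves_before t (p ++ leftmost_path (odflt Leaf (subtree t p))) = leaves_before t p.
Proof.
elim: t p => [|l IHl r IHr] [|[] p] //=.
- by elim: l {IHl IHr} => //=.
- by rewrite IHr.
Qed.

(** Descending to the left skips no leaf, so the label of a node can be read off
    the node itself. *)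
Lemma rhoE (F : indexed_forest) (v : fnode) :
  rho F v = (leaf_offset F v.1 + leaves_before (F v.1) v.2).+1.
Proof. by rewrite /rho /leaf_label /= leaves_before_leftmost. Qed.

(** * Forests with one terminal label *)

Definition terminal_at (t : bintree) (p : seq bool) : bool :=
  [&& internal_at t p, leaf_at t (rcons p false) & leaf_at t (rcons p true)].

Lemma terminal_exists (t : bintree) : t <> Leaf -> exists p, terminal_at t p.
Proof.
elim: t => // l IHl r IHr _; case: l IHl => [_|l1 l2 /(_ ltac:(by []))[p tp]].
  case: r IHr => [_|r1 r2 /(_ ltac:(by []))[p tp]]; first by exists [::].
  by exists (true :: p).
by exists (false :: p).
Qed.

Lemma leaves_before_lt (t : bintree) (p : seq bool) : leaves_before t p < nleaves t.
Proof.
elim: t p => [|l IHl r IHr] [|[] p] //=.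
- by rewrite addn_gt0 (leq_ltn_trans _ (IHl [::])).
- by rewrite ltn_add2l.
- by rewrite ltn_addr.
Qed.

Lemma leaf_offset_step (F : indexed_forest) (i j : nat) : i < j ->
  leaf_offset F i + nleaves (F i) <= leaf_offset F j.
Proof.
move=> ij; rewrite /leaf_offset -!(big_mkord xpredT (fun k => nleaves (F k))).
rewrite -(big_nat_recr _ _ (fun k => nleaves (F k))) //=.
by rewrite (big_cat_nat (leq0n i.+1) ij) leq_addr.
Qed.

(** Terminal nodes of two trees have different labels, because the leaves of the
    earlier tree all come before those of the later one. *)
Lemma ZigZag_single_tree (n : nat) (F : indexed_forest) : ZigZag n F ->
  exists i t, F = single_tree i t.
Proof.
move=> FZ; have [[i Fi]|F0] := pselect (exists i, F i <> Leaf); last first.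
  exists 0, Leaf; apply: indexed_forest_ext => j /=; rewrite if_same.
  by apply: contrapT => Fj; apply: F0; exists j.
have label j p : terminal_at (F j) p -> (leaf_offset F j + leaves_before (F j) p).+1 = n.
  by move=> tp; rewrite -[LHS](rhoE F (j, p)); apply: FZ; exists (j, p).
have one j k : F j <> Leaf -> F k <> Leaf -> ~~ (j < k).
  move=> /terminal_exists[p tp] /terminal_exists[q tq]; apply/negP => jk.
  have := leaf_offset_step F jk; move: (label _ _ tp); rewrite -(label _ _ tq) => -[].
  move=> eqo le; have := leaves_before_lt (F j) p.
  by rewrite -(ltn_add2l (leaf_offset F j)) eqo ltnNge (leq_trans le) ?leq_addr.
exists i, (F i); apply: indexed_forest_ext => j /=; case: eqP => [->//|ji].
apply: contrapT => Fj; apply: ji; apply/eqP.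
by rewrite eqn_leq (leqNgt j) (leqNgt i) !one.
Qed.

(** At each node one of the two subtrees is a leaf: terminal nodes of the left
    subtree have smaller labels than those of the right subtree. The sequence
    is rebuilt from the root: the new value [s.+1] is the label of the root, and
    it stays or rises by one according to the side of the internal child. *)
Lemma one_terminal_tree (n s : nat) (t : bintree) : t <> Leaf ->
  (forall p, terminal_at t p -> (s + leaves_before t p).+1 = n) ->
  exists2 b, rev_QSeq n (s.+1 :: b) & t = zigzag_tree (steps (s.+1 :: b)).
Proof.
elim: t s => // l IHl r IHr s _ tn.
have [l0|[p tp]] : l = Leaf \/ exists p, terminal_at l p.
- by case: l {IHl tn} => [|l1 l2]; [left|right; apply: terminal_exists].
- subst l; case: r IHr tn => [|r1 r2] IHr tn.
    by exists [::]; rewrite /= ?eqxx //; split=> //=; rewrite -(tn [::]) ?addn0.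
  have [//|p tp|b bn ->] := IHr s.+1.
    by rewrite addSn -addnS; apply: tn (true :: p) tp.
  exists (s.+2 :: b); last by rewrite /= (ltn_eqF (ltnSn s.+1)).
  by case: bn => pos hd st; split=> //=; apply/andP; split; rewrite // /slow_rise eqxx orbT.
have r0 : r = Leaf.
  apply: contrapT => /terminal_exists[q tq].
  have := tn (true :: q) tq; rewrite -(tn (false :: p) tp) => -[/= /addnI].
  have := leaves_before_lt l p; rewrite ltnNge => /negP lp e.
  by apply: lp; rewrite -e leq_addr.
subst r; have [|p' tp'|b bn ->] := IHl s.
- by move=> l0; move: tp; rewrite l0; case: (p) => [|[]].
- exact: tn (false :: p') tp'.
exists (s.+1 :: b); last by rewrite /= eqxx.
by case: bn => pos hd st; split=> //=; apply/andP; split; rewrite // /slow_rise eqxx.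
Qed.

(** * The bijection *)

Lemma internal_zigzag_forest (i : nat) (d : seq bool) (v : fnode) :
  internal (single_tree i (zigzag_tree d)) v <->
  exists2 j, j < size d & v = (i, take j d).
Proof.
case: v => k p; rewrite /internal /=; case: eqP => [->|ki]; last first.
  split; first by case: p => [|[]].
  by case=> j _ [/ki].
rewrite internal_zigzag prefixE; split=> [/andP[pd /eqP dp]|[j jd [->]]].
  by exists (size p); rewrite ?dp.
by rewrite size_takel ?jd ?eqxx // ltnW.
Qed.

Lemma rho_zigzag_forest (i : nat) (d : seq bool) (j : nat) :
  rho (single_tree i (zigzag_tree d)) (i, take j d) = (i + count id (take j d)).+1.
Proof. by rewrite rhoE /= eqxx leaf_offset_single_tree leaves_before_zigzag. Qed.

(** The labels along the path spell out the sequence, since a label increases by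
    one at a right turn and a right turn is a rise of the sequence. *)
Lemma zigzag_label (n : nat) (b : seq nat) (j : nat) : rev_QSeq n b -> j < size b ->
  ((head n b).-1 + count id (take j (steps b))).+1 = nth 0 b j.
Proof.
move=> bn jb; rewrite (nth_rev_QSeq bn jb); case: b bn jb => //= x b bn _.
by case/rev_QSeq_cons: bn; case: x.
Qed.

Lemma zigzag_single_child (d : seq bool) (i j : nat) (c : bool) : j < size d ->
  internal (single_tree i (zigzag_tree d)) (i, rcons (take j d) c) <->
  j.+1 < size d /\ c = nth false d j.
Proof.
move=> jd; rewrite internal_zigzag_forest; split=> [[k kd [e]]|[jd1 ->]]; last first.
  by exists j.+1; rewrite // (take_nth false).
have kj : k = j.+1.
  by have := congr1 size e; rewrite size_rcons !size_takel // ltnW.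
move: e; rewrite kj (take_nth false) // => /rcons_inj[->].
by rewrite -kj.
Qed.

(** A terminal node has no internal child, so it is the last node of the path,
    and its label is the last entry of the sequence. *)
Lemma ZigZag_zigzag_forest (n : nat) (b : seq nat) : rev_QSeq n b ->
  ZigZag n (single_tree (head n b).-1 (zigzag_tree (steps b))).
Proof.
move=> bn _ [v tv <-] /=; set F := single_tree _ _ in tv *.
have /and3P[/internal_zigzag_forest[j jd vE] tl tr] : terminal F v := tv.
have child c : leaf F (v.1, rcons v.2 c) -> ~~ internal F (v.1, rcons v.2 c).
  by rewrite /leaf /internal /leaf_at /internal_at; case: subtree => // -[].
have jb : j.+1 = size b.
  apply/eqP; rewrite -(size_steps b) eqn_leq jd leqNgt; apply/negP => j1d.
  have : ~~ internal F (v.1, rcons v.2 (nth false (steps b) j)).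
    by case: nth; apply: child.
  by rewrite vE; move/negP; apply; apply/(zigzag_single_child _ _ jd).
rewrite vE rho_zigzag_forest zigzag_label // -?jb //.
case: bn => _ + _; case: (b) jb => //= x b' [->] <-.
by rewrite -(last_nth 0).
Qed.

Lemma QSeq_seq_forest_bij (n : nat) : 1 <= n ->
  set_bij (QSeq n) (ZigZag n) seq_forest.
Proof.
move=> n0; split.
- move=> a; rewrite -(revK a) => /QSeq_rev bn.
  by rewrite /= (seq_forest_single_tree n0 bn); apply: ZigZag_zigzag_forest.
- move=> a c; rewrite !inE -(revK a) -(revK c) => /QSeq_rev bn /QSeq_rev cn.
  rewrite (seq_forest_single_tree n0 bn) (seq_forest_single_tree n0 cn) => e; congr rev; move: e bn cn.
  case: (rev a) (rev c) => [|x b] [|y c'] //.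
  + by move=> /esym/single_tree_inj[] //=; case: ifP.
  + by move=> /single_tree_inj[] //=; case: ifP.
  move=> /single_tree_inj[] /=; first by case: ifP.
  move=> exy e bn cn; apply: (zigzag_steps_inj bn cn) => //=.
  by case/rev_QSeq_cons: bn cn => _ x0 _ /rev_QSeq_cons[_ y0 _]; rewrite -(prednK x0) exy prednK.
- move=> F FZ; have [i [t Ft]] := ZigZag_single_tree FZ.
  have [b bn ->] : exists2 b, rev_QSeq n b & F = seq_forest (rev b); last first.
    by exists (rev b) => //; apply/QSeq_rev.
  have [t0|t0] := pselect (t = Leaf).
    exists [::]; first by [].
    rewrite (seq_forest_single_tree n0) // Ft t0.
    by apply: indexed_forest_ext => j /=; rewrite !if_same.
  have [p tp|b bn tE] := @one_terminal_tree n i t t0.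
    rewrite -[LHS]/(i + _).+1 -[in LHS](leaf_offset_single_tree i t).
    have := rhoE (single_tree i t) (i, p); rewrite /= eqxx => <-; rewrite -Ft.
    apply: FZ; exists (i, p) => //; rewrite /= Ft /terminal /internal /leaf /=.
    by rewrite !eqxx.
  by exists (i.+1 :: b) => //; rewrite (seq_forest_single_tree n0 bn) /= Ft tE.
Qed.

(** * Equality of the polynomials *)

(** The conditions that compatible sequences and forest labelings share once
    both are indexed by depth. Adding the rise of [b] to the left-hand side
    makes the inequality strict exactly where [b] goes up. *)
Definition increasing_filling (b r : seq nat) : Prop :=
  size r = size b /\ forall j, j < size b ->
    0 < nth 0 r j <= nth 0 b j /\
    (j.+1 < size b -> nth 0 r j + nth false (steps b) j <= nth 0 r j.+1).

(** Reversal exchanges the pair of positions j, j+1 with the pair k-j-2, k-j-1,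
    so decreasing turns into increasing. *)
Lemma compatible_seq_rev (n : nat) (b r : seq nat) : rev_QSeq n b ->
  compatible_seq (rev b) (rev r) <-> increasing_filling b r.
Proof.
move=> bn; set k := size b.
have up j : j.+1 < k -> nth 0 b j.+1 = nth 0 b j + nth false (steps b) j.
  move=> jb; have jb' := ltnW jb.
  rewrite (nth_rev_QSeq bn jb) (nth_rev_QSeq bn jb').
  by rewrite (take_nth false) ?size_steps // -cats1 count_cat /= addn0 addnA.
have nth_last (s : seq nat) j : size s = k -> j < k ->
    nth 0 (rev s) j = nth 0 s (k - j.+1).
  by move=> sk jk; rewrite nth_rev sk.
rewrite /compatible_seq /increasing_filling /= !size_rev -/k.
split=> [[rk bnd weak strict]|[rk fill]].
  split=> // j jk; split.
    have jk' : k - j.+1 < k by lia.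
    have := bnd _ jk'; rewrite !nth_last //.
    by rewrite (_ : k - (k - j.+1).+1 = j) //; lia.
  move=> jk1; have jk' : (k - j.+2).+1 < k by lia.
  have e1 : k - (k - j.+2).+1 = j.+1 by lia.
  have e2 : k - (k - j.+2).+2 = j by lia.
  have := weak _ jk'; have := strict _ jk'; rewrite !nth_last ?(ltnW jk') //.
  rewrite e1 e2 up //.
  by case: nth => /= str wk; lia.
have fill1 j : j.+1 < k -> [/\ k - j.+1 = (k - j.+2).+1,
    nth 0 r (k - j.+2) + nth false (steps b) (k - j.+2) <= nth 0 r (k - j.+2).+1 &
    nth 0 b (k - j.+2).+1 = nth 0 b (k - j.+2) + nth false (steps b) (k - j.+2)].
  move=> jk; have [jk1 jk2] : k - j.+2 < k /\ (k - j.+2).+1 < k by lia.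
  have [_ /(_ jk2) f] := fill _ jk1.
  by split; [lia|exact: f|exact: up].
split=> // j jk.
- by rewrite !nth_last //; have [|] := fill (k - j.+1); first lia.
- by have [e] := fill1 _ jk; rewrite !nth_last ?(ltnW jk) // e; lia.
- by have [e] := fill1 _ jk; rewrite !nth_last ?(ltnW jk) // e; case: nth; lia.
Qed.

Definition depth_labeling (F : indexed_forest) (r : seq nat) : IN F -> nat :=
  fun v => nth 0 r (size (val v).2).
Arguments depth_labeling : clear implicits.

Lemma internal_spine (i : nat) (d : seq bool) (j : nat) : j < size d ->
  internal (single_tree i (zigzag_tree d)) (i, take j d).
Proof. by move=> jd; apply/internal_zigzag_forest; exists j. Qed.

Definition spine_node (i : nat) (d : seq bool) (j : nat) (jd : j < size d) :
    IN (single_tree i (zigzag_tree d)) :=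
  exist (fun v => internal _ v) (i, take j d) (internal_spine i jd).

Lemma spine_node_onto (i : nat) (d : seq bool) (v : IN (single_tree i (zigzag_tree d))) :
  exists (j : nat) (jd : j < size d), v = spine_node i jd.
Proof.
case: v => v iv; have [j jd vE] := (internal_zigzag_forest _ _ _).1 iv.
by exists j, jd; apply: val_inj.
Qed.

Lemma depth_labeling_spine (i : nat) (d : seq bool) (r : seq nat) (j : nat)
  (jd : j < size d) : depth_labeling _ r (spine_node i jd) = nth 0 r j.
Proof. by rewrite /depth_labeling /= size_takel // ltnW. Qed.

(** The internal child of the node of depth j is the node of depth j+1, on the
    side given by the step of [b] at j: a left child gives the weak inequality and
    a right child the strict one. The bound by [rho] is the bound by [b]
    because of [zigzag_label]. *)
Lemma compatible_depth_labeling (n : nat) (b r : seq nat) :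
  rev_QSeq n b -> size r = size b ->
  let F := single_tree (head n b).-1 (zigzag_tree (steps b)) in
  compatible_lab F (depth_labeling F r) <-> increasing_filling b r.
Proof.
move=> bn rb F; set i := (head n b).-1 in F *; set d := steps b in F *.
have dk : size d = size b := size_steps b.
have rhob j (jd : j < size d) : rho F (val (spine_node i jd)) = nth 0 b j.
  by rewrite [LHS]rho_zigzag_forest zigzag_label // -dk.
split=> [comp|[_ fill] v].
  split=> // j jb; have jd : j < size d by rewrite dk.
  have [] := comp (spine_node i jd); rewrite rhob depth_labeling_spine.
  move=> bnd le lt; split=> //; rewrite -dk => j1d.
  have wE : val (spine_node i j1d) = (i, rcons (take j d) (nth false d j)).
    by rewrite /= (take_nth false).
  have := lt (spine_node i j1d); have := le (spine_node i j1d).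
  rewrite wE depth_labeling_spine.
  by case: nth {wE} => [_ /(_ erefl)|/(_ erefl) + _]; rewrite ?addn1 ?addn0.
have [j [jd ->]] := spine_node_onto v.
have [bnd step] := fill j (leq_trans jd (eq_leq dk)).
have child w c : val w = (i, rcons (take j d) c) ->
    nth 0 r j + c <= depth_labeling F r w.
  move=> wE; have : internal F (i, rcons (take j d) c) by rewrite -wE; apply: valP.
  case/(zigzag_single_child _ _ jd) => j1d cE.
  rewrite (_ : w = spine_node i j1d) ?depth_labeling_spine ?cE ?step -?dk //.
  by apply: val_inj; rewrite wE cE /= (take_nth false).
rewrite rhob depth_labeling_spine; split=> // w /child.
  by rewrite addn0.
by rewrite addn1.
Qed.

Lemma depth_labeling_surj (i : nat) (d : seq bool)
    (F := single_tree i (zigzag_tree d)) (kappa : IN F -> nat) :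
  exists2 r, size r = size d & kappa = depth_labeling F r.
Proof.
exists [seq kappa (spine_node i (ltn_ord j)) | j <- enum 'I_(size d)].
  by rewrite size_map size_enum_ord.
apply/funext => v; have [j [jd ->]] := spine_node_onto v.
rewrite depth_labeling_spine (nth_map (Ordinal jd)) ?size_enum_ord //.
by congr kappa; apply: val_inj; rewrite /= nth_enum_ord.
Qed.

Lemma depth_labeling_inj (i : nat) (d : seq bool) (r s : seq nat)
    (F := single_tree i (zigzag_tree d)) : size r = size d -> size s = size d ->
  depth_labeling F r = depth_labeling F s -> r = s.
Proof.
move=> rd sd rs; apply: (@eq_from_nth _ 0); rewrite rd // => j jd.
by have := congr1 (fun f => f (spine_node i jd)) rs; rewrite !depth_labeling_spine.
Qed.

Lemma prod_depth_labeling (i : nat) (d : seq bool) (r : seq nat)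
    (F := single_tree i (zigzag_tree d)) : size r = size d ->
  (\big[*%R/1]_(v \in [set: IN F]%classic) xvar (depth_labeling F r v) =
   \prod_(x <- r) xvar x)%R.
Proof.
move=> rd.
pose nodes : seq (IN F) := [seq spine_node i (ltn_ord j) | j <- enum 'I_(size d)].
have nodesT : [set: IN F]%classic = [set` nodes]%classic.
  apply/seteqP; split=> // v _ /=; have [j [jd ->]] := spine_node_onto v.
  by apply/mapP; exists (Ordinal jd); rewrite ?mem_enum //; apply: val_inj.
rewrite nodesT -fsbig_seq; last first.
  rewrite map_inj_uniq ?enum_uniq // => j k [] /(congr1 size).
  by rewrite !size_takel ?(ltnW (ltn_ord _)) // => /val_inj.
rewrite big_map big_enum (big_nth 0) big_mkord rd /=.
by apply: eq_bigr => j _; rewrite depth_labeling_spine.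
Qed.

Lemma slide_poly_zigzag (n : nat) (b : seq nat) : rev_QSeq n b ->
  slide_poly (rev b) =
  forest_poly (single_tree (head n b).-1 (zigzag_tree (steps b))).
Proof.
move=> bn; rewrite /forest_poly; set F := single_tree _ _.
have compb s : compatible_seq (rev b) s -> size (rev s) = size (steps b).
  by case=> sb _ _ _; rewrite size_steps size_rev sb size_rev.
rewrite (reindex_fsbig (fun s => depth_labeling F (rev s)) (compatible_seq (rev b))).
  apply: eq_fsbigr => s; rewrite inE => /compb sb.
  by rewrite prod_depth_labeling //; apply: perm_big; rewrite perm_sym perm_rev.
split.
- move=> s cs /=; apply: (compatible_depth_labeling bn _).2.
    by rewrite compb // size_steps.
  by apply: (compatible_seq_rev _ bn).1; rewrite revK.
- move=> s t; rewrite !inE => /compb sb /compb tb /(depth_labeling_inj sb tb).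
  by move/(can_inj revK).
- move=> kappa ck; have [r rd kE] := depth_labeling_surj kappa.
  exists (rev r); last by rewrite revK.
  apply: (compatible_seq_rev _ bn).2; apply: (compatible_depth_labeling bn _).1.
    by rewrite rd size_steps.
  by rewrite -kE.
Qed.

Theorem theorem8p3 (n : nat) (hn : 1 <= n) :
  set_bij (QSeq n) (ZigZag n) seq_forest /\
  (forall a : seq nat, QSeq n a -> slide_poly a = forest_poly (seq_forest a)).
Proof.
split=> [|a]; first exact: QSeq_seq_forest_bij.
rewrite -(revK a) => /QSeq_rev an.
by rewrite (seq_forest_single_tree hn an); apply: slide_poly_zigzag.
Qed.
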